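(* Let $\Theta\subset\mathbb{R}\times(0,\infty)$ be open. For $(\mu,\sigma)\in\Theta$ let $X=\exp(\mu+\sigma Z)$ with $Z\sim N(0,1)$, and for $s>0$ let $\varphi_s(x)=\exp(-x^2/(2s^2))$. For each integer $j\ge0$ put $${}^{(\varphi_s)}m_j(\mu,\sigma)=\mathrm{E}_{(\mu,\sigma)}\bigl[X^j\varphi_s(X)\bigr].$$ Then for each $s>0$ and each $(\mu,\sigma)\in\Theta$ there exist moment orders $j_0<j_1$ (depending on $(\mu,\sigma,s)$) such that the Jacobian with respect to $(\mu,\sigma)$ of the map $$(\mu,\sigma)\mapsto\bigl({}^{(\varphi_s)}m_{j_0}(\mu,\sigma),\;{}^{(\varphi_s)}m_{j_1}(\mu,\sigma)\bigr)$$ has rank $2$ at $(\mu,\sigma)$. In particular, for each $s>0$ and any compact $\Theta_0\subset\Theta$, there exists a finite set of moment orders $j_0<\cdots<j_K$ such that the feature map $$\Phi_{\varphi_s}=\bigl({}^{(\varphi_s)}m_{j_0},\ldots,{}^{(\varphi_s)}m_{j_K}\bigr):\Theta_0\to\mathbb{R}^{K+1}$$ is an immersion, i.e. its Jacobian has rank $2$ at every point of $\Theta_0$.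
   Context: $\mathrm{E}_{(\mu,\sigma)}$ denotes expectation when $X$ has the log-normal law with parameters $(\mu,\sigma)$, whose density is $f_{\mu,\sigma}(x)=(x\sigma\sqrt{2\pi})^{-1}\exp(-(\ln x-\mu)^2/(2\sigma^2))$ on $(0,\infty)$. Moment orders are nonnegative integers. *)

(* Defs.v *)
From HB Require Import structures.
From mathcomp Require Import all_boot all_order all_algebra.
From mathcomp Require Import all_classical all_reals all_analysis.

Set Implicit Arguments.
Unset Strict Implicit.
Unset Printing Implicit Defensive.

Import Order.TTheory GRing.Theory Num.Theory.
Import numFieldNormedType.Exports.

Local Open Scope classical_set_scope.
Local Open Scope ring_scope.

(* A parameter point (mu, sigma) is the row vector th with th 0 0 = mu and
   th 0 1 = sigma. *)
Definition mu_of (R : realType) (th : 'rV[R]_2) : R := th 0 0.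
Definition sigma_of (R : realType) (th : 'rV[R]_2) : R := th 0 1.

Definition std_normal d (T : measurableType d) (R : realType)
    (P : probability T R) (Z : {RV P >-> R}) : Prop :=
  forall A : set R, measurable A -> distribution P Z A = normal_prob 0 1 A.

Definition lognormal d (T : measurableType d) (R : realType)
    (Z : T -> R) (th : 'rV[R]_2) : T -> R :=
  fun w => expR (mu_of th + sigma_of th * Z w).

Definition gauss_weight (R : realType) (s x : R) : R :=
  expR (- (x ^+ 2 / (2 * s ^+ 2))).

(* [fine] only turns the extended-real expectation into a real number; for
   [phi = gauss_weight s] with [0 < s] the integrand is bounded on the range
   of X, so the expectation is finite. *)
Definition weighted_moment d (T : measurableType d) (R : realType)
    (P : probability T R) (Z : T -> R) (phi : R -> R) (j : nat)
    (th : 'rV[R]_2) : R :=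
  fine ('E_P[(fun w => lognormal Z th w ^+ j * phi (lognormal Z th w))%R])%E.

Definition feature_map d (T : measurableType d) (R : realType)
    (P : probability T R) (Z : T -> R) (phi : R -> R) (n : nat)
    (js : n.-tuple nat) (th : 'rV[R]_2) : 'rV[R]_n :=
  \row_(i < n) weighted_moment P Z phi (tnth js i) th.

(* ['J f th] is meaningful only where [f] is differentiable (it is built from
   a default value otherwise).  It acts on row vectors, hence is the transpose
   of the usual Jacobian matrix, which has the same rank. *)
Definition jacobian_rank2 (R : realType) (n : nat)
    (f : 'rV[R]_2 -> 'rV[R]_n) (th : 'rV[R]_2) : Prop :=
  differentiable f th /\ \rank ('J f th) = 2%N.

(* Main.v *)
Require Import Defs.
From HB Require Import structures.
From mathcomp Require Import all_boot all_order all_algebra.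
From mathcomp Require Import all_classical all_reals all_analysis.
From mathcomp Require Import measurable_realfun ring lra.

Set Implicit Arguments.
Unset Strict Implicit.
Unset Printing Implicit Defensive.

Import Order.TTheory GRing.Theory Num.Theory.
Import numFieldNormedType.Exports.

Local Open Scope classical_set_scope.
Local Open Scope ring_scope.

(** The pair of moment orders (0, 2) works at every parameter point with
    sigma > 0, whatever the scale s, and so it serves a whole set of parameters
    at once.  Both assertions follow from this.

    Put e_j(y) = exp(j y) phi_s(exp y), so that the weighted moment of order j
    is E[e_j(Y)] with Y = mu + sigma Z.  Two facts carry the proof.

    Differentiability.  The functions e_j are bounded, and
    e_j' = j e_j - s^-2 e_(j+2) stays in their span; hence e_j' and e_j'' are
    bounded too.  Taylor's formula bounds the error of
    e_j(y + k) ~ e_j(y) + e_j'(y) k by a multiple of k^2, uniformly in y.  A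
    displacement (a, b) of the parameter moves Y by k = a + b Z, and Z has a
    finite second moment, so integrating this bound shows that the moment is
    Frechet differentiable, with differential
    (a, b) |-> E[(a + b Z) e_j'(Y)]
    (lemma weighted_moment_quadratic_remainder).

    Rank.  Suppose that (a, b) is killed by the differentials of the moments of
    orders 0 and 2.  As e_0' = - s^-2 e_2 and e_2' = 2 e_2 - s^-2 e_4, this
    means E[(a + b Z) e_2(Y)] = E[(a + b Z) e_4(Y)] = 0.  Let X = exp Y, so
    that e_4(Y) = X^2 e_2(Y).  If b <> 0, the affine function a + b Z vanishes
    exactly at Z = z0 := - a / b, where X takes a value x0, and X - x0 has the
    sign of Z - z0.  Therefore b (a + b Z) (X^2 - x0^2) e_2(Y) is nonnegative
    and vanishes only for Z = z0, an event of probability 0; its expectation is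
    positive, yet it is a combination of the two vanishing expectations.  So
    b = 0, and then a E[e_2(Y)] = 0 gives a = 0 (lemma affine_moments_eq0). *)

(** * Quadratic remainders and differentials *)

Lemma is_derive_continuous (R : realType) (f df : R -> R) :
  (forall x : R, is_derive x 1 f (df x)) -> continuous f.
Proof.
move=> fd x; apply/differentiable_continuous/derivable1_diffP.
exact: (@ex_derive _ _ _ _ _ _ _ (fd x)).
Qed.

Lemma bounded_derivative_lipschitz (R : realType) (f df : R -> R) (C : R) :
  (forall x : R, is_derive x 1 f (df x)) -> (forall x, `|df x| <= C) ->
  forall x y, `|f y - f x| <= C * `|y - x|.
Proof.
move=> fd dfC; have cf := is_derive_continuous fd.
have le_case x y : x <= y -> `|f y - f x| <= C * `|y - x|.
  move=> xy.
  have [c _ ->] := MVT_segment xy (fun z _ => fd z) (continuous_subspaceT cf).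
  by rewrite normrM ler_wpM2r.
move=> x y; have [|/ltW] := leP x y; first exact: le_case.
by move/le_case; rewrite distrC (distrC x).
Qed.

(** The mean value theorem, applied to t |-> f (y + t k) - f'(y) k t on [0, 1],
    writes the remainder as (f'(y + c k) - f'(y)) k, and f' is C-Lipschitz.  The
    factor 1/2 of Taylor's formula is lost, which is harmless here. *)
Lemma taylor1_quadratic_remainder (R : realType) (f df ddf : R -> R) (C : R) :
  (forall x : R, is_derive x 1 f (df x)) ->
  (forall x : R, is_derive x 1 df (ddf x)) ->
  (forall x, `|ddf x| <= C) ->
  forall y k, `|f (y + k) - f y - df y * k| <= C * k ^+ 2.
Proof.
move=> fd dfd ddfC y k.
pose g t := f (y + t * k) - df y * k * t.
have gd (t : R) : is_derive t 1 g (df (y + t * k) * k - df y * k).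
  have fyd : is_derive t 1 (fun t => f (y + t * k)) (df (y + t * k) * k).
    have yd : is_derive t (1 : R) (fun t => y + t * k) k.
      by apply: is_derive_eq; rewrite add0r scaler0 add0r mul1r; exact: mulr1.
    exact: (@is_derive1_comp _ f (fun t => y + t * k) t _ _ (fd _) yd).
  rewrite /g; apply: is_derive_eq; congr (_ - _); exact: mulr1.
have cg := is_derive_continuous gd.
have [c + gE] := MVT_segment ler01 (fun z _ => gd z) (continuous_subspaceT cg).
rewrite in_itv /= => /andP[c0 c1].
have -> : f (y + k) - f y - df y * k = g 1 - g 0.
  by rewrite /g mul1r mul0r !mulr1 mulr0 subr0 addr0; ring.
have C0 : 0 <= C := le_trans (normr_ge0 _) (ddfC 0).
have := bounded_derivative_lipschitz dfd ddfC y (y + c * k).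
rewrite [y + c * k - y]addrC addKr normrM (ger0_norm c0) => le1.
rewrite gE subr0 mulr1 -mulrBl normrM -[k ^+ 2]ger0_norm ?sqr_ge0// normrX.
rewrite expr2 mulrA ler_wpM2r// (le_trans le1)//.
by rewrite mulrCA ler_piMl// mulr_ge0.
Qed.

(** A remainder of order 2 is a little-o, so it pins down the differential. *)
Lemma diff_quadratic_remainder (R : realType) (V W : normedModType R)
    (f : V -> W) (df : {linear V -> W}) (x : V) (C : R) :
  continuous df ->
  (forall h, `|f (h + x) - f x - df h| <= C * `|h| ^+ 2) ->
  differentiable f x /\ 'd f x = df :> (V -> W).
Proof.
move=> cdf rem.
have fo : f \o shift x = cst (f x) + df +o_ 0 id.
  apply/eqaddoP => e e0; near=> h.
  rewrite [X in `|X|](_ : _ = f (h + x) - f x - df h); last first.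
    by rewrite -addrA -opprD.
  apply: (le_trans (rem h)); rewrite expr2 mulrA ler_wpM2r//.
  (* |C| + 1 instead of C: a positive factor, by which one can divide. *)
  rewrite (@le_trans _ _ ((`|C| + 1) * `|h|))//.
    by rewrite ler_wpM2r// (le_trans (ler_norm _))// lerDl.
  rewrite -ler_pdivlMl ?ltr_wpDl//.
  by near: h; apply: nbhs0_le; rewrite mulr_gt0 ?invr_gt0 ?ltr_wpDl.
have dfE : 'd f x = df :> (V -> W) by exact: diff_unique fo.
by split => //; apply/diff_locallyP; rewrite dfE.
Unshelve. all: by end_near. Qed.

Lemma normr_row_coord_le (R : realType) (n : nat) (v : 'rV[R]_n) i :
  `|v 0 i| <= `|v|.
Proof.
rewrite [leRHS]mx_normrE.
exact: (le_bigmax _ (fun ij : 'I_1 * 'I_n => `|v ij.1 ij.2|) (0, i)).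
Qed.

Lemma continuous_mulmxr (R : realType) (m n : nat) (A : 'M[R]_(m, n)) :
  continuous (mulmxr A : 'rV[R]_m -> 'rV[R]_n).
Proof.
apply/linear_bounded_continuous/bounded_funP => r.
exists (\sum_i \sum_j `|r| * `|A j i|) => h hr.
rewrite [leLHS]mx_normrE; apply: bigmax_le => [|[i j] _ /=].
  by do 2![apply: sumr_ge0 => ? _]; rewrite mulr_ge0.
rewrite (ord1 i) mxE (bigD1 j)//= ler_wpDr//.
  by do 2![apply: sumr_ge0 => ? _]; rewrite mulr_ge0.
apply: (le_trans (ler_norm_sum _ _ _)); apply: ler_sum => k _.
rewrite normrM ler_wpM2r//.
by rewrite (le_trans (normr_row_coord_le _ _))// (le_trans hr)// ler_norm.
Qed.

(** The criterion of [diff_quadratic_remainder] read coordinatewise, the form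
    needed for a map whose coordinates are integrals. *)
Lemma jacobian_quadratic_remainder (R : realType) (m n : nat)
    (f : 'rV[R]_m -> 'rV[R]_n) (x : 'rV[R]_m) (A : 'M[R]_(m, n)) (C : R) :
  (forall h i, `|f (h + x) 0 i - f x 0 i - (h *m A) 0 i| <= C * `|h| ^+ 2) ->
  differentiable f x /\ 'J f x = A.
Proof.
move=> fA.
have rem (h : 'rV[R]_m) : `|f (h + x) - f x - mulmxr A h| <= `|C| * `|h| ^+ 2.
  rewrite [leLHS]mx_normrE; apply: bigmax_le => [|[i j] _ /=].
    by rewrite mulr_ge0// sqr_ge0.
  rewrite (ord1 i) mxE [X in X + _]mxE [X in _ + X]mxE [X in _ + X + _]mxE.
  rewrite (le_trans (fA h j))//.
  by rewrite ler_wpM2r ?sqr_ge0// ler_norm.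
have [fd dfE] := diff_quadratic_remainder (@continuous_mulmxr _ _ _ A) rem.
split => //.
by apply/row_matrixP => i; rewrite /jacobian !rowE mul_rV_lin1 dfE.
Qed.

(** * Moments of a standard normal variable *)

(** The density agrees almost everywhere with the Radon-Nikodym derivative of
    the normal law, since both have the same integral on each Borel set; the
    change of variables known for the derivative then holds for the density. *)
Lemma ge0_integral_normal_prob (R : realType) (m s : R) (f : R -> \bar R) :
  s != 0 -> measurable_fun setT f -> (forall x, 0 <= f x)%E ->
  (\int[normal_prob m s]_x f x =
   \int[lebesgue_measure]_x (f x * (normal_pdf m s x)%:E))%E.
Proof.
move=> s0 mf f0.
have dom := @normal_prob_dominates R m s.
rewrite -(Radon_Nikodym_SigmaFinite.change_of_variables dom)//.
have iRN := Radon_Nikodym_SigmaFinite.f_integrable dom.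
have mpdf : measurable_fun [set: R] (fun x => (normal_pdf m s x)%:E).
  by apply/measurable_EFinP; exact: measurable_normal_pdf.
apply: ae_eq_integral => //.
- exact: (emeasurable_funM mf (measurable_int _ iRN)).
- exact: (emeasurable_funM mf mpdf).
- apply: ae_eqe_mul2l; apply: integral_ae_eq => // E _ mE.
  by rewrite -(Radon_Nikodym_SigmaFinite.f_integral dom).
Qed.

(** Half of the Gaussian decay absorbs the square: with u = y^2 / 4,
    y^2 exp(- 2 u) = 4 u exp(- u) exp(- u) <= 4 exp(- u), and exp(- u) is, up
    to normalization, the normal density of variance 2. *)
Lemma sqr_mul_normal_pdf_le (R : realType) (y : R) :
  y ^+ 2 * normal_pdf 0 1 y <=
  4 * normal_peak 1 / normal_peak (Num.sqrt 2) * normal_pdf 0 (Num.sqrt 2) y.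
Proof.
have s20 : Num.sqrt 2 != 0 :> R by rewrite sqrtr_eq0 -ltNge.
rewrite !normal_pdfE ?oner_eq0// mulrA -!mulrA.
rewrite (mulrA (_^-1)) mulVf ?gt_eqF ?normal_peak_gt0// mul1r.
rewrite (mulrA y y) -expr2 mulrCA [leRHS]mulrCA ler_wpM2l ?normal_peak_ge0//.
rewrite /normal_fun subr0 sqr_sqrtr// expr1n.
set u := y ^+ 2 / 4.
have -> : - y ^+ 2 / (1 *+ 2) = - u + - u by rewrite /u; field.
have -> : - y ^+ 2 / (2 *+ 2) = - u by rewrite /u; field.
rewrite expRD mulrA ler_wpM2r ?expR_ge0//.
have -> : y ^+ 2 = 4 * u by rewrite /u; field.
rewrite expRN ler_pdivrMr ?expR_gt0// ler_wpM2l//.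
by rewrite (le_trans _ (expR_ge1Dx u))// lerDr.
Qed.

Lemma normal_prob_second_moment_lty (R : realType) :
  (\int[@normal_prob R 0 1]_y (y ^+ 2)%:E < +oo)%E.
Proof.
have msq : measurable_fun setT (fun y : R => (y ^+ 2)%:E).
  by apply/measurable_EFinP; exact: measurable_funX.
have mpdf : measurable_fun setT (fun y : R => (normal_pdf 0 1 y)%:E).
  by apply/measurable_EFinP; exact: measurable_normal_pdf.
rewrite ge0_integral_normal_prob ?oner_eq0//; last first.
  by move=> y; rewrite lee_fin sqr_ge0.
pose K : R := 4 * normal_peak 1 / normal_peak (Num.sqrt 2).
have := integrableZl measurableT K (@integrable_normal_pdf R 0 (Num.sqrt 2)).
move=> /integrableP[mK]; apply: le_lt_trans; apply: ge0_le_integral => //.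
- by move=> y _; rewrite -EFinM lee_fin mulr_ge0 ?sqr_ge0 ?normal_pdf_ge0.
- exact: (emeasurable_funM msq mpdf).
- exact: measurableT_comp.
- move=> y _; rewrite -!EFinM abse_EFin lee_fin.
  exact: le_trans (sqr_mul_normal_pdf_le y) (ler_norm _).
Qed.

(** The second moment is what makes the remainder terms integrable. *)
Lemma std_normal_integrable_sqr (R : realType) (d : measure_display)
    (T : measurableType d) (P : probability T R) (Z : {RV P >-> R}) :
  std_normal Z -> P.-integrable [set: T] (EFin \o (fun w => Z w ^+ 2)).
Proof.
move=> nZ.
have msq : measurable_fun setT (fun y : measurableTypeR R => (y ^+ 2)%:E).
  by apply/measurable_EFinP; exact: measurable_funX.
(* The Borel sets of R carry two structures with different displays; Z' is Z
   seen with values in the one on which the normal law is a measure. *)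
have mZ : @measurable_fun _ _ T (measurableTypeR R) setT Z.
  exact (measurable_funPT Z).
pose ZM := isMeasurableFun.Build _ _ T (measurableTypeR R) Z mZ.
pose Z' : {mfun T >-> measurableTypeR R} :=
  HB.pack (Z : T -> measurableTypeR R) ZM.
apply/integrableP; split.
  by apply/measurable_EFinP; apply: measurable_funX; exact: measurable_funPT.
rewrite (eq_integral (fun w => (Z w ^+ 2)%:E)) => [|w _]; last first.
  by rewrite /= ger0_norm ?sqr_ge0.
have E : (\int[distribution P Z']_y (y ^+ 2)%:E = \int[P]_w (Z w ^+ 2)%:E)%E.
  by apply: ge0_integral_distribution => // y; rewrite lee_fin sqr_ge0.
rewrite -E (eq_measure_integral (@normal_prob R 0 1)); last first.
  by move=> A mA _; exact: nZ.
exact: normal_prob_second_moment_lty.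
Qed.

Lemma std_normal_integrable (R : realType) (d : measure_display)
    (T : measurableType d) (P : probability T R) (Z : {RV P >-> R}) :
  std_normal Z -> P.-integrable [set: T] (EFin \o Z).
Proof.
move=> nZ.
have i1 : P.-integrable [set: T] (EFin \o cst (1 : R)).
  exact: finite_measure_integrable_cst.
have := integrableD measurableT i1 (std_normal_integrable_sqr nZ).
apply: le_integrable => //.
  by apply/measurable_EFinP; exact: measurable_funPT.
move=> w _ /=; rewrite lee_fin [leRHS]ger0_norm; last first.
  by rewrite addr_ge0 ?sqr_ge0.
rewrite -[Z w ^+ 2]real_normK ?num_real//; have := sqr_ge0 (`|Z w| - 1); nra.
Qed.

Lemma std_normal_set1 (R : realType) (d : measure_display)
    (T : measurableType d) (P : probability T R) (Z : {RV P >-> R}) (c : R) :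
  std_normal Z -> P [set w | Z w = c] = 0%E.
Proof.
move=> nZ; rewrite probability_distribution nZ//.
have /null_content_dominatesP := @normal_prob_dominates R 0 1.
by apply; [exact: measurable_set1|exact: lebesgue_measure_set1].
Qed.

(** * The moment integrand in logarithmic coordinates *)

(** The function x^j phi_s(x) at x = exp y.  The logarithmic coordinate y turns
    the dependence of X on (mu, sigma) into an affine one. *)
Definition moment_integrand (R : realType) (s : R) (j : nat) (y : R) : R :=
  expR y ^+ j * gauss_weight s (expR y).

(** The derivative of [moment_integrand s j] in y; it is again a combination of
    moment integrands, so one boundedness lemma serves all derivatives. *)
Definition dmoment_integrand (R : realType) (s : R) (j : nat) (y : R) : R :=
  j%:R * moment_integrand s j y - s ^- 2 * moment_integrand s j.+2 y.

Lemma moment_integrand_gt0 (R : realType) (s : R) (j : nat) (y : R) :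
  0 < moment_integrand s j y.
Proof. by rewrite mulr_gt0 ?exprn_gt0 ?expR_gt0. Qed.

Lemma is_derive_moment_integrand (R : realType) (s : R) (j : nat) (y : R) :
  s != 0 ->
  is_derive y 1 (moment_integrand s j) (dmoment_integrand s j y).
Proof.
move=> s0.
have eqf : moment_integrand s j =
    expR \o (fun y => j%:R * y - (2 * s ^+ 2)^-1 * expR y ^+ 2).
  apply/funext => x; rewrite /= expRD expRM_natl /moment_integrand.
  by rewrite /gauss_weight [_ / _]mulrC.
have gd : is_derive y 1 (fun y => j%:R * y - (2 * s ^+ 2)^-1 * expR y ^+ 2)
    (j%:R - s ^- 2 * expR y ^+ 2).
  apply: is_derive_eq; rewrite /GRing.scale /=; field.
  exact: s0.
have := is_derive1_comp (is_derive_expR _) gd.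
rewrite -[X in is_derive _ _ X _ -> _]/(expR \o _) -eqf => /is_derive_eq; apply.
rewrite -[expR (_ - _)]/((expR \o (fun y : R => _)) y) -eqf.
rewrite /dmoment_integrand /moment_integrand.
rewrite -[j.+2]/(2 + j)%N (exprD _ 2 j); ring.
Qed.

(** Put u = x^2 / (2 s^2) with x = exp y.  Then x^j <= 1 + x^(2 j), and
    x^(2 j) = (2 s^2)^j u^j is beaten by phi_s(x) = exp(- u), because
    u^j <= j! exp u. *)
Lemma moment_integrand_bounded (R : realType) (s : R) (j : nat) :
  s != 0 -> exists C, forall y, moment_integrand s j y <= C.
Proof.
move=> s0; exists (1 + (2 * s ^+ 2) ^+ j * j`!%:R) => y.
rewrite /moment_integrand /gauss_weight; set x := expR y.
have S0 : 0 < 2 * s ^+ 2 by rewrite mulr_gt0// exprn_even_gt0.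
set u := x ^+ 2 / (2 * s ^+ 2).
have u0 : 0 <= u by rewrite divr_ge0 ?sqr_ge0// ltW.
have uj : u ^+ j <= j`!%:R * expR u.
  case: j => [|j]; first by rewrite expr0 fact0 mul1r -expR0 ler_expR.
  rewrite mulrC -ler_pdivrMr ?ltr0n ?fact_gt0//.
  by rewrite (le_trans _ (expR_ge1Dxn j u0))// lerDr.
have xj : x ^+ j <= 1 + (2 * s ^+ 2) ^+ j * u ^+ j.
  rewrite -exprMn [_ * u]mulrC divfK ?gt_eqF// exprAC.
  have := sqr_ge0 (x ^+ j - 1); have := exprn_ge0 j (expR_ge0 y).
  rewrite -/x; nra.
rewrite expRN ler_pdivrMr ?expR_gt0// (le_trans xj)// [leRHS]mulrDl mul1r.
rewrite -[X in _ <= _ + X]mulrA.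
rewrite lerD ?ler_wpM2l ?exprn_ge0 ?(ltW S0)//.
by rewrite -expR0 ler_expR.
Qed.

Lemma continuous_moment_integrand (R : realType) (s : R) (j : nat) :
  s != 0 -> continuous (moment_integrand s j).
Proof.
move=> s0; apply: is_derive_continuous => y.
exact: is_derive_moment_integrand.
Qed.

Lemma normr_moment_integrand_bounded (R : realType) (s : R) (j : nat) :
  s != 0 -> exists C, forall y, `|moment_integrand s j y| <= C.
Proof.
move=> /(moment_integrand_bounded j)[C hC]; exists C => y.
by rewrite gtr0_norm ?moment_integrand_gt0.
Qed.

Definition ddmoment_integrand (R : realType) (s : R) (j : nat) (y : R) : R :=
  j%:R * dmoment_integrand s j y - s ^- 2 * dmoment_integrand s j.+2 y.

Lemma is_derive_dmoment_integrand (R : realType) (s : R) (j : nat) (y : R) :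
  s != 0 -> is_derive y 1 (dmoment_integrand s j) (ddmoment_integrand s j y).
Proof.
move=> s0.
have d0 := is_derive_moment_integrand j y s0.
have d2 := is_derive_moment_integrand j.+2 y s0.
exact: (is_deriveB (is_deriveZ j%:R d0) (is_deriveZ (s ^- 2) d2)).
Qed.

Lemma continuous_dmoment_integrand (R : realType) (s : R) (j : nat) :
  s != 0 -> continuous (dmoment_integrand s j).
Proof.
move=> s0; apply: is_derive_continuous => y.
exact: is_derive_dmoment_integrand.
Qed.

Lemma bounded_linear_combination (R : realType) (f g : R -> R) (a b : R) :
  (exists C, forall y, `|f y| <= C) -> (exists C, forall y, `|g y| <= C) ->
  exists C, forall y, `|a * f y - b * g y| <= C.
Proof.
move=> [C hC] [D hD]; exists (`|a| * C + `|b| * D) => y.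
by rewrite (le_trans (ler_normB _ _))// !normrM lerD// ler_wpM2l.
Qed.

Lemma dmoment_integrand_bounded (R : realType) (s : R) (j : nat) :
  s != 0 -> exists C, forall y, `|dmoment_integrand s j y| <= C.
Proof.
move=> s0; apply: bounded_linear_combination;
  exact: normr_moment_integrand_bounded.
Qed.

Lemma moment_integrand_quadratic_remainder (R : realType) (s : R) (j : nat) :
  s != 0 -> exists C, forall y k,
    `|moment_integrand s j (y + k) - moment_integrand s j y
      - dmoment_integrand s j y * k| <= C * k ^+ 2.
Proof.
move=> s0.
have [C hC] : exists C, forall y, `|ddmoment_integrand s j y| <= C.
  by apply: bounded_linear_combination; exact: dmoment_integrand_bounded.
exists C; apply: taylor1_quadratic_remainder hC => y.
  exact: is_derive_moment_integrand.
exact: is_derive_dmoment_integrand.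
Qed.

(** * Expectations of functions of mu + sigma Z *)

Lemma weighted_momentE (d : measure_display) (T : measurableType d)
    (R : realType) (P : probability T R) (Z : T -> R) (s : R) (j : nat)
    (th : 'rV[R]_2) :
  weighted_moment P Z (gauss_weight s) j th =
  \int[P]_w moment_integrand s j (mu_of th + sigma_of th * Z w).
Proof. by rewrite /weighted_moment unlock. Qed.

Lemma integrable_mul_bounded_comp (R : realType) (d : measure_display)
    (T : measurableType d) (P : probability T R) (Z : {RV P >-> R})
    (f : T -> R) (g : R -> R) (a b : R) :
  P.-integrable [set: T] (EFin \o f) ->
  continuous g -> (exists C, forall y, `|g y| <= C) ->
  P.-integrable [set: T] (EFin \o (fun w => f w * g (a + b * Z w))).
Proof.
move=> fi cg [C gC].
have mY : measurable_fun setT (fun w => a + b * Z w).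
  by apply: measurable_funD => //; apply: measurable_funM.
have mgY : measurable_fun setT (fun w => g (a + b * Z w)).
  exact: (measurableT_comp (continuous_measurable_fun cg) mY).
have bgY : [bounded g (a + b * Z w) | w in [set: T]].
  exists C; split; first exact: num_real.
  by move=> M CM w _ /=; exact: le_trans (gC _) (ltW CM).
exact: (integrableMl measurableT fi mgY bgY).
Qed.

Lemma integrable_affine (R : realType) (d : measure_display)
    (T : measurableType d) (P : probability T R) (Z : {RV P >-> R}) (a b : R) :
  P.-integrable [set: T] (EFin \o Z) ->
  P.-integrable [set: T] (EFin \o (fun w => a + b * Z w)).
Proof.
move=> Zi.
have c1 : P.-integrable [set: T] (EFin \o cst a).
  exact: finite_measure_integrable_cst.
exact: (integrableD measurableT c1 (integrableZl measurableT b Zi)).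
Qed.

Lemma Rintegral_affine_mul (R : realType) (d : measure_display)
    (T : measurableType d) (P : probability T R) (Z : {RV P >-> R})
    (f : R -> R) (a b mu sigma : R) :
  P.-integrable [set: T] (EFin \o Z) ->
  continuous f -> (exists C, forall y, `|f y| <= C) ->
  \int[P]_w ((a + b * Z w) * f (mu + sigma * Z w)) =
  a * \int[P]_w f (mu + sigma * Z w) +
  b * \int[P]_w (Z w * f (mu + sigma * Z w)).
Proof.
move=> Zi cf fb.
have i1 : P.-integrable [set: T] (EFin \o (fun w => f (mu + sigma * Z w))).
  have c1 : P.-integrable [set: T] (EFin \o cst (1 : R)).
    exact: finite_measure_integrable_cst.
  have := integrable_mul_bounded_comp Z mu sigma c1 cf fb.
  by apply: eq_integrable => // w _ /=; rewrite mul1r.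
have i2 := integrable_mul_bounded_comp Z mu sigma Zi cf fb.
rewrite -!RintegralZl// -RintegralD//.
- by apply: eq_Rintegral => w _; rewrite mulrDl mulrA.
- exact: (integrableZl measurableT a i1).
- exact: (integrableZl measurableT b i2).
Qed.

(** * Differentiability of the weighted moments *)

(** The column of the two partial derivatives: d Y / d mu = 1 and
    d Y / d sigma = Z. *)
Definition moment_gradient (R : realType) (d : measure_display)
    (T : measurableType d) (P : probability T R) (Z : T -> R) (s : R) (j : nat)
    (th : 'rV[R]_2) : 'cV[R]_2 :=
  \col_i \int[P]_w ((if i == 0 then 1 else Z w) *
                    dmoment_integrand s j (mu_of th + sigma_of th * Z w)).

Lemma mulmx_moment_gradient (R : realType) (d : measure_display)
    (T : measurableType d) (P : probability T R) (Z : {RV P >-> R}) (s : R)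
    (j : nat) (th h : 'rV[R]_2) :
  std_normal Z -> s != 0 ->
  (h *m moment_gradient P Z s j th) 0 0 =
  \int[P]_w ((mu_of h + sigma_of h * Z w) *
             dmoment_integrand s j (mu_of th + sigma_of th * Z w)).
Proof.
move=> nZ s0; rewrite Rintegral_affine_mul//.
- rewrite mxE !big_ord_recl big_ord0 addr0 !mxE/=; congr (_ * _ + _ * _).
    by apply: eq_Rintegral => w _; rewrite mul1r.
  by congr (h 0 _); apply/val_inj.
- exact: std_normal_integrable.
- exact: continuous_dmoment_integrand.
- exact: dmoment_integrand_bounded.
Qed.

(** The parameter displacement h moves Y = mu + sigma Z by k = h_0 + h_1 Z.  The
    pointwise Taylor remainder is at most C k^2 <= 2 C |h|^2 (1 + Z^2), whose
    expectation is a multiple of |h|^2. *)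
Lemma weighted_moment_quadratic_remainder (R : realType) (d : measure_display)
    (T : measurableType d) (P : probability T R) (Z : {RV P >-> R}) (s : R)
    (j : nat) :
  std_normal Z -> s != 0 -> exists C, forall th h : 'rV[R]_2,
  `|weighted_moment P Z (gauss_weight s) j (h + th)
    - weighted_moment P Z (gauss_weight s) j th
    - (h *m moment_gradient P Z s j th) 0 0| <= C * `|h| ^+ 2.
Proof.
move=> nZ s0; have [C rem] := moment_integrand_quadratic_remainder j s0.
have C0 : 0 <= C.
  by have := le_trans (normr_ge0 _) (rem 0 1); rewrite expr1n mulr1.
have i1 : P.-integrable [set: T] (EFin \o cst (1 : R)).
  exact: finite_measure_integrable_cst.
have iZ := std_normal_integrable nZ.
have iZ2 := std_normal_integrable_sqr nZ.
have iq : P.-integrable [set: T] (EFin \o (fun w => 1 + Z w ^+ 2)).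
  exact: (integrableD measurableT i1 iZ2).
have cm := @continuous_moment_integrand R s j s0.
have bm := normr_moment_integrand_bounded j s0.
have im a b : P.-integrable [set: T]
    (EFin \o (fun w => moment_integrand s j (a + b * Z w))).
  have := integrable_mul_bounded_comp Z a b i1 cm bm.
  by apply: eq_integrable => // w _ /=; rewrite mul1r.
exists (2 * C * \int[P]_w (1 + Z w ^+ 2)) => th h.
rewrite mulmx_moment_gradient// !weighted_momentE.
set k := fun w => mu_of h + sigma_of h * Z w.
set y := fun w => mu_of th + sigma_of th * Z w.
have ykE w : mu_of (h + th) + sigma_of (h + th) * Z w = y w + k w.
  by rewrite /y /k /mu_of /sigma_of !mxE; ring.
have id : P.-integrable [set: T]
    (EFin \o (fun w => k w * dmoment_integrand s j (y w))).
  apply: integrable_mul_bounded_comp.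
  - exact: integrable_affine.
  - exact: continuous_dmoment_integrand.
  - exact: dmoment_integrand_bounded.
have id1 : P.-integrable [set: T] (EFin \o (fun w =>
    moment_integrand s j (mu_of (h + th) + sigma_of (h + th) * Z w)
    - moment_integrand s j (y w))).
  exact: (integrableB measurableT (im _ _) (im _ _)).
have id2 := integrableB measurableT id1 id.
rewrite -RintegralB// -RintegralB//.
apply: (le_trans (le_normr_Rintegral measurableT id2)).
have iB := integrableZl measurableT (2 * C * `|h| ^+ 2) iq.
rewrite [leRHS]mulrAC -RintegralZl//.
apply: le_Rintegral => //; first exact: (integrable_norm id2).
move=> w _; rewrite ykE [_ * dmoment_integrand _ _ _]mulrC.
apply: (le_trans (rem _ _)).
have hk : k w ^+ 2 <= `|h| ^+ 2 * (2 * (1 + Z w ^+ 2)).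
  have h0 := normr_row_coord_le h 0; have h1 := normr_row_coord_le h 1.
  have : `|k w| <= `|h| * (1 + `|Z w|).
    rewrite (le_trans (ler_normD _ _))// normrM mulrDr mulr1.
    by rewrite lerD// ler_wpM2r.
  rewrite -(ler_pXn2r (ltn0Sn 1)) ?nnegrE ?mulr_ge0 ?addr_ge0//.
  rewrite real_normK ?num_real// => /le_trans; apply.
  rewrite exprMn ler_wpM2l ?sqr_ge0// -[Z w ^+ 2]real_normK ?num_real//.
  by have := sqr_ge0 (`|Z w| - 1); nra.
rewrite (le_trans (ler_wpM2l C0 hk))//.
by rewrite le_eqVlt; apply/orP; left; apply/eqP; ring.
Qed.

(** * Nondegeneracy of the differential *)

(** A nonnegative function with zero integral vanishes almost surely; here this
    would force Z = c almost surely, although Z has no atom. *)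
Lemma Rintegral_gt0_off_point (R : realType) (d : measure_display)
    (T : measurableType d) (P : probability T R) (Z : {RV P >-> R})
    (f : T -> R) (c : R) :
  std_normal Z -> P.-integrable [set: T] (EFin \o f) ->
  (forall w, 0 <= f w) -> (forall w, f w = 0 -> Z w = c) ->
  0 < \int[P]_w f w.
Proof.
move=> nZ fi f0 fZ; rewrite lt0r Rintegral_ge0// andbT; apply/negP => /eqP If0.
have If : (\int[P]_w `|(EFin \o f) w| = 0)%E.
  rewrite (eq_integral (EFin \o f)) => [|w _]; last first.
    by rewrite gee0_abs ?lee_fin.
  rewrite -[LHS]fineK; last exact: integrable_fin_num.
  by congr (_%:E).
have aef := (ae_eq_integral_abs P measurableT (measurable_int P fi)).1 If.
have nc : P.-negligible [set w | Z w = c].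
  apply/negligibleP; last exact: std_normal_set1.
  have := measurable_funPT Z measurableT _ (measurable_set1 c).
  by rewrite setTI.
have nT : P.-negligible [set: T].
  apply: negligibleS (negligibleU aef nc) => w _.
  have [Zc|Zc] := pselect (Z w = c); [by right|left=> /= fw].
  by apply/Zc/fZ; have [] := fw I.
have PT0 : P [set: T] = 0%E by apply: measure_negligible.
by move/eqP: PT0; rewrite probability_setT eqe oner_eq0.
Qed.

Lemma expectation_dmoment_integrand (R : realType) (d : measure_display)
    (T : measurableType d) (P : probability T R) (Z : {RV P >-> R})
    (s : R) (j : nat) (f : T -> R) (a b : R) :
  P.-integrable [set: T] (EFin \o f) -> s != 0 ->
  \int[P]_w (f w * dmoment_integrand s j (a + b * Z w)) =
  j%:R * \int[P]_w (f w * moment_integrand s j (a + b * Z w))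
  - s ^- 2 * \int[P]_w (f w * moment_integrand s j.+2 (a + b * Z w)).
Proof.
move=> fi s0.
have im i : P.-integrable [set: T]
    (EFin \o (fun w => f w * moment_integrand s i (a + b * Z w))).
  apply: integrable_mul_bounded_comp => //.
    exact: continuous_moment_integrand.
  exact: normr_moment_integrand_bounded.
rewrite -!RintegralZl// -RintegralB//.
- by apply: eq_Rintegral => w _; rewrite /dmoment_integrand; ring.
- exact: (integrableZl measurableT j%:R (im j)).
- exact: (integrableZl measurableT (s ^- 2) (im j.+2)).
Qed.

(** The sign-change argument, with X = exp (mu + sigma Z): if b <> 0, then
    a + b Z changes sign once, at Z = z0, and so does X^2 - x0^2 when x0 is the
    value of X there.  Their product has constant sign, while its weighted
    expectation combines the two vanishing ones. *)
Lemma affine_moments_eq0 (R : realType) (d : measure_display)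
    (T : measurableType d) (P : probability T R) (Z : {RV P >-> R})
    (s mu sigma a b : R) (j : nat) :
  std_normal Z -> s != 0 -> 0 < sigma ->
  \int[P]_w ((a + b * Z w) * moment_integrand s j (mu + sigma * Z w)) = 0 ->
  \int[P]_w ((a + b * Z w) * moment_integrand s j.+2 (mu + sigma * Z w)) = 0 ->
  a = 0 /\ b = 0.
Proof.
move=> nZ s0 sig0 I2 I4.
set y := fun w => mu + sigma * Z w.
have iab : P.-integrable [set: T] (EFin \o (fun w => a + b * Z w)).
  exact/integrable_affine/std_normal_integrable.
have im i : P.-integrable [set: T]
    (EFin \o (fun w => (a + b * Z w) * moment_integrand s i (y w))).
  apply: integrable_mul_bounded_comp => //.
    exact: continuous_moment_integrand.
  exact: normr_moment_integrand_bounded.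
have [b0|b0] := eqVneq b 0.
  (* If a <> 0, the function a (a e_j(Y)) is positive everywhere: the point 0
     below is arbitrary. *)
  split=> //; apply/eqP/negPn/negP => a0.
  have := integrableZl measurableT a (im j).
  move=> /(Rintegral_gt0_off_point (c := 0) nZ) /=.
  rewrite RintegralZl// I2 mulr0 ltxx => absurd; suff: false by [].
  apply: absurd => w; rewrite b0 mul0r addr0 mulrA.
    by rewrite -expr2 mulr_ge0 ?sqr_ge0// ltW// moment_integrand_gt0.
  move=> /eqP; rewrite mulf_eq0 [X in _ || X]gt_eqF ?moment_integrand_gt0//.
  by rewrite orbF -expr2 sqrf_eq0 (negbTE a0).
exfalso.
pose z0 := - a / b; pose x0 := expR (mu + sigma * z0).
have ix0 := integrableZl measurableT (x0 ^+ 2) (im j).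
have id : P.-integrable [set: T] (EFin \o (fun w =>
    (a + b * Z w) * moment_integrand s j.+2 (y w)
    - x0 ^+ 2 * ((a + b * Z w) * moment_integrand s j (y w)))).
  exact: (integrableB measurableT (im _) ix0).
have := integrableZl measurableT b id.
move=> /(Rintegral_gt0_off_point (c := z0) nZ) /=.
rewrite RintegralZl// RintegralB// RintegralZl// I2 I4 mulr0 subr0 mulr0 ltxx.
move=> absurd; suff: false by [].
(* The factor b makes the leading coefficient b^2 positive, so that the two
   signs of b need not be distinguished. *)
have fE w : b * ((a + b * Z w) * moment_integrand s j.+2 (y w)
    - x0 ^+ 2 * ((a + b * Z w) * moment_integrand s j (y w))) =
  b ^+ 2 * (expR (y w) + x0) * moment_integrand s j (y w)
  * ((Z w - z0) * (expR (y w) - x0)).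
  rewrite /moment_integrand -[j.+2]/(2 + j)%N exprD /z0; field.
  exact: b0.
have pos w : 0 < b ^+ 2 * (expR (y w) + x0) * moment_integrand s j (y w).
  rewrite mulr_gt0 ?moment_integrand_gt0// mulr_gt0 ?addr_gt0 ?expR_gt0//.
  by rewrite exprn_even_gt0.
apply: absurd => w; rewrite fE.
  rewrite pmulr_rge0//; have [Zz|/ltW Zz] := leP (Z w) z0.
    rewrite mulr_le0// subr_le0// ler_expR lerD2l ler_pM2l//.
  by rewrite mulr_ge0// subr_ge0// ler_expR lerD2l ler_pM2l.
move=> /eqP; rewrite mulf_eq0 gt_eqF//= mulf_eq0 !subr_eq0.
by move=> /orP[/eqP//|/eqP/expR_inj/addrI/(mulfI (lt0r_neq0 sig0))].
Qed.

(** * The feature map *)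

Lemma mulmx_matrix_of_cols (R : pzSemiRingType) (m n : nat) (h : 'rV[R]_m)
    (c : 'I_n -> 'cV[R]_m) (k : 'I_n) :
  (h *m \matrix_(i, k) c k i 0) 0 k = (h *m c k) 0 0.
Proof. by rewrite !mxE; apply: eq_bigr => i _; rewrite mxE. Qed.

Lemma feature_map_jacobian (R : realType) (d : measure_display)
    (T : measurableType d) (P : probability T R) (Z : {RV P >-> R}) (s : R)
    (n : nat) (js : n.-tuple nat) (th : 'rV[R]_2) :
  std_normal Z -> s != 0 ->
  differentiable (feature_map P Z (gauss_weight s) js) th /\
  'J (feature_map P Z (gauss_weight s) js) th =
    \matrix_(i, k) moment_gradient P Z s (tnth js k) th i 0.
Proof.
move=> nZ s0.
have /choice[C rem] j := weighted_moment_quadratic_remainder j nZ s0.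
apply: (jacobian_quadratic_remainder (C := \sum_(j <- js) `|C j|)) => h k.
rewrite mulmx_matrix_of_cols.
rewrite [X in `|X - _ - _|]mxE [X in `|_ - X - _|]mxE.
apply: (le_trans (rem _ _ _)).
rewrite ler_wpM2r ?sqr_ge0// (le_trans (ler_norm _))//.
rewrite big_tuple (bigD1 k)//= lerDl sumr_ge0//.
Qed.

(** A row vector in the kernel of the Jacobian gives, by e_0' = - s^-2 e_2, the
    relation E[(a + b Z) e_2(Y)] = 0, and then, by e_2' = 2 e_2 - s^-2 e_4,
    also E[(a + b Z) e_4(Y)] = 0. *)
Lemma feature_map_rank2 (R : realType) (d : measure_display)
    (T : measurableType d) (P : probability T R) (Z : {RV P >-> R}) (s : R)
    (th : 'rV[R]_2) :
  std_normal Z -> s != 0 -> 0 < sigma_of th ->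
  jacobian_rank2 (feature_map P Z (gauss_weight s) [tuple 0%N; 2%N]) th.
Proof.
move=> nZ s0 sig0.
have [fd JE] := feature_map_jacobian [tuple 0%N; 2%N] th nZ s0.
split=> //; rewrite JE; apply/eqP; apply: inj_row_free => v vJ.
have grad k : (v *m moment_gradient P Z s (tnth [tuple 0%N; 2%N] k) th) 0 0 = 0.
  rewrite -(mulmx_matrix_of_cols v
    (fun k => moment_gradient P Z s (tnth [tuple 0%N; 2%N] k) th)).
  by rewrite vJ mxE.
have iv : P.-integrable [set: T]
    (EFin \o (fun w => mu_of v + sigma_of v * Z w)).
  exact/integrable_affine/std_normal_integrable.
have := grad 0; rewrite mulmx_moment_gradient//.
rewrite expectation_dmoment_integrand// mul0r sub0r => /eqP.
rewrite oppr_eq0 mulf_eq0 invr_eq0 expf_eq0 (negbTE s0) andbF /= => /eqP I2.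
have := grad 1; rewrite mulmx_moment_gradient//.
rewrite expectation_dmoment_integrand// [X in _ * X - _]I2 mulr0 sub0r => /eqP.
rewrite oppr_eq0 mulf_eq0 invr_eq0 expf_eq0 (negbTE s0) andbF /= => /eqP I4.
have [v0 v1] := affine_moments_eq0 nZ s0 sig0 I2 I4.
apply/rowP => i; rewrite mxE; case: (unliftP 0 i) => [k|] ->; last exact: v0.
by rewrite (ord1 k) -[RHS]v1; congr (v 0 _); apply/val_inj.
Qed.

Theorem proposition5p7 (R : realType) (d : measure_display)
    (T : measurableType d) (P : probability T R) (Z : {RV P >-> R})
    (Theta : set 'rV[R]_2) :
  std_normal Z ->
  open Theta ->
  (forall th, Theta th -> 0 < sigma_of th) ->
  forall s : R, 0 < s ->
  (forall th, Theta th ->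
     exists j0 j1 : nat, (j0 < j1)%N /\
       jacobian_rank2 (feature_map P Z (gauss_weight s) [tuple j0; j1]) th) /\
  (forall Theta0 : set 'rV[R]_2, compact Theta0 -> Theta0 `<=` Theta ->
     exists (K : nat) (js : K.+1.-tuple nat), sorted ltn js /\
       forall th, Theta0 th ->
         jacobian_rank2 (feature_map P Z (gauss_weight s) js) th).
Proof.
move=> nZ _ sig0 s /lt0r_neq0 s0; split=> [th Tth|Theta0 _ sub].
  exists 0%N, 2%N; split=> //.
  exact: (feature_map_rank2 nZ s0 (sig0 _ Tth)).
exists 1%N, [tuple 0%N; 2%N]; split=> // th Tth.
exact: (feature_map_rank2 nZ s0 (sig0 _ (sub _ Tth))).
Qed.
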